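(* Let $n\ge 1$ and let $a_1,\ldots,a_n\in\mathbb{C}$ be fixed and pairwise distinct. Then there is a proper Zariski-closed subset $Z\subset\mathbb{C}^{n-1}$ such that for all $(b_1,\ldots,b_{n-1})\in\mathbb{C}^{n-1}\setminus Z$ the polynomial $\chi_n(\lambda,w)$ is irreducible in $\mathbb{C}[\lambda,w]$.
   Context: For $a_1,\ldots,a_n,b_1,\ldots,b_{n-1}\in\mathbb{C}$ let $A=\operatorname{diag}(a_1,\ldots,a_n)$ and let $B$ be the $n\times n$ symmetric tridiagonal matrix with zero diagonal and entries $B_{i,i+1}=B_{i+1,i}=b_i$ for $1\le i\le n-1$. The spectral polynomial is $\chi_n(\lambda,w)=\det(\lambda I+A+wB)\in\mathbb{C}[\lambda,w]$. *)

(* Defs.v *)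
From mathcomp Require Import all_boot all_algebra.
From mathcomp Require Import complex mpoly.
From mathcomp Require Import classical_sets reals.
Set Implicit Arguments.
Unset Strict Implicit.
Unset Printing Implicit Defensive.
Import GRing.Theory.
Local Open Scope ring_scope.

Section SpectralPolynomial.
Variables (K : comNzRingType) (n : nat).

Definition diagA (a : 'I_n -> K) : 'M[K]_n := diag_mx (\row_i a i).

(* Indices start at 0: b k is the common value of the entries (k, k+1) and
   (k+1, k), k < n-1. For each (i, j) the sum has at most one term, and none
   when |i - j| <> 1. *)
Definition tridiagB (b : 'I_n.-1 -> K) : 'M[K]_n :=
  \matrix_(i, j) \sum_(k < n.-1 | ((i == k :> nat) && (j == k.+1 :> nat))
                               || ((i == k.+1 :> nat) && (j == k :> nat))) b k.

Definition lambda : {mpoly K[2]} := 'X_ord0.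
Definition w : {mpoly K[2]} := 'X_ord_max.

Definition chi (a : 'I_n -> K) (b : 'I_n.-1 -> K) : {mpoly K[2]} :=
  \det (lambda%:M + map_mx (@mpolyC 2 K) (diagA a)
        + w *: map_mx (@mpolyC 2 K) (tridiagB b)).

Lemma tridiagB_up (b : 'I_n.-1 -> K) (k : 'I_n.-1) (i j : 'I_n) :
  i = k :> nat -> j = k.+1 :> nat -> tridiagB b i j = b k.
Proof.
move=> ik jk; rewrite mxE (big_pred1 k) // => l /=.
rewrite ik jk eqSS andbb eq_sym -val_eqE.
apply/orb_idr => /andP[/eqP -> /eqP /esym].
by move/eqP; rewrite -addn2 -[X in X == _]addn0 eqn_add2l.
Qed.

Lemma tridiagB_tr (b : 'I_n.-1 -> K) : (tridiagB b)^T = tridiagB b.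
Proof.
apply/matrixP => i j; rewrite !mxE; apply: eq_bigl => k.
by rewrite orbC [X in X || _]andbC [X in _ || X]andbC.
Qed.

Lemma tridiagB_far (b : 'I_n.-1 -> K) (i j : 'I_n) :
  j != i.+1 :> nat -> i != j.+1 :> nat -> tridiagB b i j = 0.
Proof.
move=> ij ji; rewrite mxE big_pred0 // => k; apply/negbTE/negP.
case/orP=> /andP[/eqP ik /eqP jk].
  by rewrite ik jk eqxx in ij.
by rewrite ik jk eqxx in ji.
Qed.

End SpectralPolynomial.

(* The library's irreducible_poly is about univariate polynomials and measures
   units by degree; this is ring-theoretic irreducibility. *)
Definition irreducible_elt (D : unitRingType) (p : D) : Prop :=
  [/\ p != 0, p \isn't a GRing.unit
    & forall q r : D, p = q * r ->
        q \is a GRing.unit \/ r \is a GRing.unit].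

(* Affine space K^m is the type of functions 'I_m -> K. *)
Definition zariski_closed (K : fieldType) (m : nat) (Z : set ('I_m -> K)) :
  Prop :=
  exists S : set {mpoly K[m]},
    forall x : 'I_m -> K, Z x <-> (forall p, S p -> p.@[x] = 0).

(* Main.v *)
From HB Require Import structures.
Require Import Defs.
From mathcomp Require Import all_boot all_algebra.
From mathcomp Require Import complex mpoly ring zify.
From mathcomp Require Import classical_sets reals.
Set Implicit Arguments.
Unset Strict Implicit.
Unset Printing Implicit Defensive.
Import GRing.Theory.
Local Open Scope ring_scope.

(** Near w = 0 the roots in lambda of chi are the branches
      rho_i(w) = - a_i + mu_i w^2 + O(w^3),
      mu_i = \sum_j B_ij B_ji / (a_j - a_i)
    ([branch], [drift]): second-order perturbation theory for the simple
    eigenvalues of A ([branch_root]).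

    Suppose chi = q r with q of degree d in lambda and 0 < d < n.  Since chi
    has total degree n and is monic of degree n in lambda, q has total degree
    d; hence its coefficient of lambda^d is constant and its coefficient of
    lambda^(d-1) has degree at most 1 in w.  Let I be the set of the i such
    that q(- a_i, 0) = 0; as the a_i are distinct, #|I| = d, and modulo w^3 the
    polynomial q is a constant times the product of the lambda - rho_i for i in
    I.  The coefficient of w^2 lambda^(d-1) in q being 0, the mu_i with i in I
    add up to 0 ([factor_root_sum], [irreducible_chi]).

    In the sum of the mu_i over I, the pairs i, j that are both in I cancel
    out, so that a term b_k^2 / (a_(k+1) - a_k) survives, up to sign, exactly
    when one of k, k+1 is in I.  When I is neither empty nor full, this happens
    for some k, so the sum is a nonzero polynomial in b ([cross_sum],
    [cross_sum_Xn_neq0]).  The set Z is the zero locus of the product of these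
    polynomials over all such I. *)

(** * Polynomials over polynomials modulo a power of the inner variable *)

Section PolynomialsOverPolynomials.
Variable K : fieldType.
Implicit Types (E Q T : {poly {poly K}}) (x : {poly K}).

(** In {poly {poly K}} the outer variable is lambda and the inner one is w;
    [spec0 E] is E at w = 0. *)
Definition spec0 : {poly {poly K}} -> {poly K} := map_poly (horner_eval 0).

Lemma spec0_horner E x : (spec0 E).[x.[0]] = E.[x].[0].
Proof. by rewrite -[x.[0]]/(horner_eval 0 x) horner_map. Qed.

Lemma coef_spec0 E k : (spec0 E)`_k = (E`_k).[0].
Proof. by rewrite coef_map. Qed.

Lemma dvdpX_horner0 x : ('X %| x) = (x.[0] == 0).
Proof. by rewrite -['X]subr0 -[0]/(0%:P) dvdp_XsubCl. Qed.

Lemma horner0_dvdpXn m x : (0 < m)%N -> 'X^m %| x -> x.[0] = 0.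
Proof.
move=> m0 dx; apply/eqP; rewrite -dvdpX_horner0.
by apply: dvdp_trans dx; rewrite -(prednK m0) exprS dvdp_mulr.
Qed.

(** A polynomial with fewer coefficients than it has approximate roots modulo
    w^m, the roots being distinct at w = 0, vanishes modulo w^m: at w = 0 it has
    too many roots, so that w can be factored out, and so on. *)
Lemma dvdpXn_coef m E (s : seq {poly K}) :
    uniq [seq x.[0] | x <- s] -> (size E <= size s)%N ->
    (forall x, x \in s -> 'X^m %| E.[x]) ->
  forall k, 'X^m %| E`_k.
Proof.
move=> us; elim: m E => [|m IH] E sE dE k; first by rewrite expr0 dvd1p.
have E0 : spec0 E = 0.
  apply: (@roots_geq_poly_eq0 _ _ [seq x.[0] | x <- s]) => //.
    apply/allP => y /mapP[x xs ->]; rewrite rootE spec0_horner.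
    by rewrite (@horner0_dvdpXn m.+1) ?dE.
  by rewrite size_map (leq_trans _ sE) ?size_poly.
pose E' := \poly_(j < size E) (E`_j %/ 'X).
have EE' : E = 'X *: E'.
  apply/polyP => j; rewrite coefZ coef_poly; case: ltnP => [_|lj].
    by rewrite mulrC divpK // dvdpX_horner0 -coef_spec0 E0 coef0.
  by rewrite nth_default ?mulr0.
rewrite EE' coefZ exprS dvdp_mul2l ?polyX_eq0 //.
apply: IH => [|x xs]; first by rewrite (leq_trans (size_poly _ _)).
by have := dE x xs; rewrite EE' hornerZ exprS dvdp_mul2l ?polyX_eq0.
Qed.

(** If the rho i are the roots of Q * T modulo w^3, then those that are roots
    of Q at w = 0 are the roots of Q modulo w^3, and their sum is there, up to a
    constant factor, the opposite of the subleading coefficient of Q, of degree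
    at most 1 in w. *)
Lemma factor_root_sum n (rho : 'I_n -> {poly K}) Q T d e :
    injective (fun i => (rho i).[0]) ->
    size Q = d.+1 -> size T = e.+1 -> (d + e = n)%N -> (0 < d)%N ->
    (size (Q`_d)%R <= 1)%N -> (size (T`_e)%R <= 1)%N -> (size (Q`_d.-1)%R <= 2)%N ->
    (forall i, 'X^3 %| (Q * T).[rho i]) ->
  exists2 I : {set 'I_n}, #|I| = d & (\sum_(i in I) rho i)`_2 = 0.
Proof.
move=> injr sQ sT den d0 cQ cT cQ1 dQT.
have roots_le P k (A := [set i | root (spec0 P) (rho i).[0]]) :
    size P = k.+1 -> (size (P`_k)%R <= 1)%N ->
    [/\ P`_k`_0 != 0, P`_k = (P`_k`_0)%:P & (#|A| <= k)%N].
  move=> sP /size1_polyC Pk.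
  have nz : P`_k`_0 != 0.
    rewrite -(polyC_eq0 P`_k`_0) -Pk; have := lead_coef_eq0 P.
    by rewrite lead_coefE sP /= => ->; rewrite -size_poly_eq0 sP.
  split=> //; rewrite cardE -(size_map (fun i => (rho i).[0])) -ltnS.
  rewrite -[X in (_ < X)%N]sP.
  apply: leq_trans (size_poly _ _ : (size (spec0 P) <= _)%N).
  apply: max_poly_roots; last by rewrite map_inj_uniq ?enum_uniq.
    apply: contraNneq nz => P0; have := coef_spec0 P k.
    by rewrite P0 coef0 Pk hornerC coefC /= => <-.
  by apply/allP => _ /mapP[i + ->]; rewrite mem_enum inE.
have [u0 Qd leI] := roots_le Q d sQ cQ.
have [_ _ leJ] := roots_le T e sT cT.
set I := [set i | _] in leI; set J := [set i | _] in leJ.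
(* Each i lies in I or J, and #|I| + #|J| <= d + e = n: I and J are therefore
   disjoint and of cardinals d and e. *)
have IJ : I :|: J = [set: 'I_n].
  apply/setP => i; rewrite !inE !rootE !spec0_horner -mulf_eq0 -hornerM.
  by rewrite -hornerM (@horner0_dvdpXn 3 _ _ (dQT i)) ?eqxx.
have := cardsUI I J; rewrite IJ cardsT card_ord => cIJ.
have cI : #|I| = d by lia.
have IJ0 : I :&: J = finset.set0 by apply/eqP; rewrite -cards_eq0; lia.
exists I => //.
set u := Q`_d`_0 in u0 Qd.
pose s := [seq rho i | i <- enum I].
have ss : size s = d by rewrite size_map -cardE.
pose E := Q - u%:P *: \prod_(x <- s) ('X - x%:P).
have sE : (size E <= size s)%N.
  apply/leq_sizeP => k; rewrite ss coefB coefZ leq_eqVlt => /predU1P[<-|dk].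
    have := monic_prod_XsubC s xpredT id; rewrite monicE lead_coefE.
    by rewrite size_prod_XsubC ss /= => /eqP ->; rewrite mulr1 Qd subrr.
  by rewrite !nth_default ?mulr0 ?subr0 // ?size_prod_XsubC ?sQ ?ss.
have dE : 'X^3 %| E`_d.-1.
  apply: (@dvdpXn_coef 3 E s) _ sE _ _ => [|_ /mapP[i iI ->]].
    by rewrite -map_comp map_inj_uniq ?enum_uniq.
  rewrite mem_enum in iI.
  have -> : E.[rho i] = Q.[rho i].
    rewrite hornerD hornerN hornerZ.
    have /rootP -> : root (\prod_(x <- s) ('X - x%:P)) (rho i).
      by rewrite root_prod_XsubC map_f // mem_enum.
    by rewrite mulr0 subr0.
  have := dQT i; rewrite hornerM Gauss_dvdpl // coprimep_expl //.
  rewrite coprimep_sym -['X]subr0 -[0]/(0%:P) coprimep_XsubC rootE -spec0_horner.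
  have := finset.in_setI i I J; rewrite IJ0 finset.in_set0 iI /=.
  by rewrite finset.in_set rootE => <-.
have : E`_d.-1`_2 = 0 by case/dvdpP: dE => y ->; rewrite coefMXn.
rewrite coefB coefZ coefB [Q`_d.-1`_2]nth_default // sub0r coefCM => /eqP.
rewrite oppr_eq0 mulf_eq0 (negbTE u0) /= -ss coefPn_prod_XsubC; last first.
  by rewrite ss -lt0n.
by rewrite coefN oppr_eq0 /s big_map big_enum => /eqP.
Qed.
End PolynomialsOverPolynomials.

(** * Perturbation of the eigenvalues *)

Section Perturbation.
Variables (K : fieldType) (n : nat) (a : 'I_n -> K) (B : 'M[K]_n).

(** The coefficient of w^2 in the i-th branch. The term j = i is 0, the
    inverse of 0 being 0. *)
Definition drift i : K := \sum_j B i j * (B j i / (a j - a i)).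

(** The expansion to order 2 of the root of det (lambda + A + w B) that is
    - a i at w = 0. *)
Definition branch i : {poly K} := (- a i)%:P + (drift i)%:P * 'X^2.

(** An approximate kernel vector v modulo w^3 with v_i = 1 is found by solving
    order by order in w; as adj M *m M *m v = det M *: v, reading the i-th
    coordinate shows that det M is 0 modulo w^3. *)
Lemma branch_root i : injective a -> (forall j, B j j = 0) ->
  'X^3 %| \det ((branch i)%:M + map_mx polyC (diagA a) + 'X *: map_mx polyC B).
Proof.
move=> inja B0; set M := (X in \det X).
pose f j := B j i / (a j - a i).
pose s j := \sum_l B j l * f l.
pose c j := s j / (a j - a i).
pose v : 'cV[{poly K}]_n := \col_j ((j == i)%:R - (f j)%:P * 'X + (c j)%:P * 'X^2).
pose t j := \sum_l B j l * c l.
(* v = e_i - w f + w^2 c; the entries f i and c i are 0. *)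
have Bv j : \sum_l (B j l)%:P * v l 0 =
    (B j i)%:P - (s j)%:P * 'X + (t j)%:P * 'X^2.
  transitivity (\sum_l (B j l)%:P * (l == i)%:R - (\sum_l (B j l * f l)%:P) * 'X
                + (\sum_l (B j l * c l)%:P) * 'X^2).
    rewrite !mulr_suml -sumrB -big_split /=; apply: eq_bigr => l _.
    by rewrite mxE !polyCM; ring.
  rewrite -!rmorph_sum (bigD1 i) //= eqxx mulr1 big1 ?addr0 // => l /negbTE ->.
  by rewrite mulr0.
have Mv : forall j, 'X^3 %| (M *m v) j 0.
  move=> j; have -> : (M *m v) j 0 =
      (branch i + (a j)%:P) * v j 0 + 'X * \sum_l (B j l)%:P * v l 0.
    rewrite mxE mulr_sumr (bigD1 j) //= [in RHS](bigD1 j) //= addrA; congr (_ + _).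
      by rewrite /M /diagA !mxE eqxx !mulr1n; ring.
    apply: eq_bigr => l; rewrite eq_sym => /negbTE lj.
    by rewrite /M /diagA !mxE lj !mulr0n polyC0; ring.
  rewrite Bv /branch.
  have [->|ji] := eqVneq j i.
    have -> : v i 0 = 1.
      by rewrite mxE eqxx /c /f subrr invr0 !mulr0 polyC0 !mul0r subr0 addr0.
    rewrite B0 -[drift i]/(s i) rmorphN /= polyC0.
    by apply/dvdpP; exists (t i)%:P; rewrite exprS; ring.
  have aji : a j - a i != 0 by rewrite subr_eq0 inj_eq.
  rewrite mxE (negbTE ji).
  have -> : B j i = f j * (a j - a i) by rewrite divfK.
  have -> : s j = c j * (a j - a i) by rewrite divfK.
  move: (f j) (c j) (t j) (drift i) => fj cj tj mu.
  apply/dvdpP; exists (mu%:P * (cj%:P * 'X - fj%:P) + tj%:P).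
  by rewrite mulr0n !polyCM !polyCB polyCN; ring.
have : (\adj M *m (M *m v)) i 0 = \det M.
  rewrite mulmxA mul_adj_mx mul_scalar_mx !mxE eqxx /c /f subrr invr0.
  by rewrite !mulr0 polyC0 !mul0r subr0 addr0 mulr1.
move=> <-; rewrite mxE.
by elim/big_rec: _ => [|l x _ dx]; rewrite ?dvdp0 ?dvdp_addr ?dvdp_mull.
Qed.
End Perturbation.

(** * The spectral polynomial in K[w][lambda] *)

(** The isomorphism from K[lambda, w] to K[w][lambda]. *)
Definition toPoly2 (K : fieldType) : {mpoly K[2]} -> {poly {poly K}} :=
  mmap (polyC \o polyC) (fun i : 'I_2 => if i == ord0 then 'X else 'X%:P).
HB.instance Definition _ (K : fieldType) := GRing.RMorphism.on (@toPoly2 K).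

Section SpectralPolynomial.
Variable K : fieldType.
Implicit Types p q : {mpoly K[2]}.

Lemma toPoly2C c : toPoly2 c%:MP = c%:P%:P :> {poly {poly K}}.
Proof. exact: mmapC. Qed.

Lemma toPoly2_lambda : toPoly2 (lambda K) = 'X.
Proof. by rewrite /toPoly2 mmapX mmap1U. Qed.

Lemma toPoly2_w : toPoly2 (w K) = 'X%:P.
Proof. by rewrite /toPoly2 mmapX mmap1U. Qed.

(** A polynomial of total degree D has a coefficient of lambda^k of degree at
    most D - k in w; sizes are degrees plus 1. *)
Lemma size_coef_toPoly2 p k : (size ((toPoly2 p)`_k)%R <= msize p - k)%N.
Proof.
rewrite /toPoly2 /mmap coef_sum; apply: (leq_trans (size_sum _ _ _)).
apply/bigmax_leqP_seq => m mp _; have := msize_mdeg_lt mp.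
rewrite mdegE /mmap1 !big_ord_recl !big_ord0 /= addn0 mulr1 mulrCA -rmorphXn.
rewrite -rmorphM coefXnM coefC /= => mlt.
case: ltnP => [_|mk]; first by rewrite size_poly0.
case: eqP => [km|_]; last by rewrite size_poly0.
apply: leq_trans (size_polyMleq _ _) _; rewrite size_polyXn size_polyC.
by case: eqP => _ /=; lia.
Qed.

Lemma toPoly2_chi n (a : 'I_n -> K) b :
  toPoly2 (chi a b) =
  char_poly (- (map_mx polyC (diagA a) + 'X *: map_mx polyC (tridiagB b))).
Proof.
rewrite /chi -det_map_mx /char_poly; congr (\det _).
apply/matrixP => i j; rewrite !mxE.
rewrite rmorphD rmorphD rmorphM rmorphMn /= toPoly2_lambda toPoly2_w !toPoly2C.
by rewrite rmorphN opprK rmorphD rmorphM addrA.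
Qed.

Lemma msize_chi n (a : 'I_n -> K) b : (msize (chi a b) <= n.+1)%N.
Proof.
have msD p q k : (msize p <= k)%N -> (msize q <= k)%N -> (msize (p + q) <= k)%N.
  by move=> pk qk; rewrite (leq_trans (mmeasureD_le _ _ _)) // geq_max pk qk.
have ms_prod (s : seq 'I_n) (F : 'I_n -> {mpoly K[2]}) :
    (forall i, msize (F i) <= 2)%N ->
    (msize (\prod_(i <- s) F i)%R <= (size s).+1)%N.
  move=> F2; elim: s => [|i s IH]; first by rewrite big_nil msize1.
  rewrite big_cons; have [->|nz] := eqVneq (F i) 0; first by rewrite mul0r msize0.
  have [->|nz'] := eqVneq (\prod_(j <- s) F j) 0; first by rewrite mulr0 msize0.
  by rewrite msizeM //= -subn1 leq_subLR (leq_add (F2 i) IH).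
apply: (big_ind (fun p => msize p <= n.+1)%N) => [|p q|s _].
- by rewrite msize0.
- exact: msD.
rewrite mulr_sign (fun_if (mmeasure mdeg)) mmeasureN if_same.
rewrite -[n in (_ <= n.+1)%N]card_ord cardT enumT; apply: ms_prod => i.
rewrite !mxE; apply: (msD _ _ 2); first apply: (msD _ _ 2).
- by case: eqP; rewrite ?mulr0n ?msize0 ?mulr1n ?msizeX ?mdeg1.
- by rewrite msizeC; case: eqP.
- rewrite mulrC mul_mpolyC (leq_trans (msizeZ_le _ _)) //.
  by rewrite msizeX mdeg1.
Qed.
End SpectralPolynomial.

(** * Sums of drifts over a set of indices *)

Section Crossing.
Variables (K : fieldType) (n : nat) (a : 'I_n -> K).

(** The sum over I of the drifts of A + w B, with the b_k in an arbitrary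
    K-algebra L of structure map iota: a polynomial ring, in order to see the
    sum as a polynomial in b, or to specialize b to powers of a variable. *)
Definition cross_sum (L : comNzRingType) (iota : K -> L) (b : 'I_n.-1 -> L)
    (I : {set 'I_n}) : L :=
  \sum_(i in I) \sum_j
    tridiagB b i j * (tridiagB b j i * iota (a j - a i)^-1).

Lemma cross_sum_morph (L : comNzRingType) (iota : K -> L) (g : {rmorphism L -> K})
    (b : 'I_n.-1 -> L) I :
    cancel iota g ->
  g (cross_sum iota b I) = \sum_(i in I) drift a (tridiagB (g \o b)) i.
Proof.
have gB i j : g (tridiagB b i j) = tridiagB (g \o b) i j.
  by rewrite !mxE rmorph_sum.
move=> gK; rewrite rmorph_sum; apply: eq_bigr => i _; rewrite rmorph_sum.
by apply: eq_bigr => j _; rewrite !rmorphM /= gK !gB.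
Qed.

Lemma boundary_step (I : {set 'I_n}) :
    I != finset.set0 -> I != [set: 'I_n] ->
  exists x y : 'I_n,
    [/\ x \in I, y \notin I & (y == x.+1 :> nat) || (x == y.+1 :> nat)].
Proof.
move=> I0 IT; case: (boolP [exists x in I, exists y in ~: I,
   (y == x.+1 :> nat) || (x == y.+1 :> nat)]) => [|none].
  case/exists_inP=> x xI /exists_inP[y yI xy]; exists x, y.
  by rewrite finset.in_setC in yI.
have step (x y : 'I_n) : y = x.+1 :> nat -> (x \in I) = (y \in I).
  move=> xy; apply/idP/idP => [xI|yI].
    apply: contraNT none => yI; apply/exists_inP; exists x => //.
    by apply/exists_inP; exists y; rewrite ?finset.in_setC // xy eqxx.
  apply: contraNT none => xI; apply/exists_inP; exists y => //.
  by apply/exists_inP; exists x; rewrite ?finset.in_setC // xy eqxx orbT.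
have walk m : forall x y : 'I_n, y = (x + m)%N :> nat -> (x \in I) = (y \in I).
  elim: m => [|m IH] x y xy; first by congr (_ \in I); apply: val_inj;
    rewrite /= xy addn0.
  have lt : (x + m < n)%N by rewrite (leq_trans _ (ltn_ord y)) // xy addnS.
  by rewrite (IH x (Ordinal lt)) // (step _ y) //= xy addnS.
case/set0Pn: I0 => x xI; case/negP: IT; apply/eqP/setP => y; rewrite finset.in_setT.
have [xy|/ltnW yx] := leqP x y; first by rewrite -(walk (y - x)%N x) // subnKC.
by rewrite (walk (x - y)%N y x) // subnKC.
Qed.

(** At b_k = t^k the sum is a polynomial in t in which the b_k^2 = t^(2k) do
    not mix: its coefficient at t^(2k) is nonzero as soon as exactly one of
    k, k+1 is in I. *)
Lemma cross_sum_Xn_neq0 I : injective a ->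
    I != finset.set0 -> I != [set: 'I_n] ->
  cross_sum polyC (fun k : 'I_n.-1 => 'X^k) I != 0.
Proof.
move=> inja I0 IT; have [x [y [xI yI xy]]] := boundary_step I0 IT.
(* The edge {x, y} is {k, k+1} for k = min x y, and 2k = (x + y).-1. *)
pose adj (i j : 'I_n) := (j == i.+1 :> nat) || (i == j.+1 :> nat).
set b := fun k => _.
have Bup (i j : 'I_n) : j = i.+1 :> nat -> tridiagB b i j = 'X^i :> {poly K}.
  move=> ij; have lt : (i < n.-1)%N by have := ltn_ord j; lia.
  by rewrite (@tridiagB_up _ _ b (Ordinal lt)).
have Bsym i j : tridiagB b i j = tridiagB b j i by rewrite -[in LHS]tridiagB_tr mxE.
have coefB (i j : 'I_n) (c : K) :
    (tridiagB b i j * (tridiagB b j i * c%:P))`_(x + y).-1 =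
    if adj i j && ((i + j)%N == (x + y)%N) then c else 0.
  have [ij|] := boolP (adj i j); last first.
    by rewrite negb_or => /andP[ij ji]; rewrite tridiagB_far // mul0r coef0.
  have -> : tridiagB b i j * (tridiagB b j i * c%:P) = c%:P * 'X^((i + j).-1).
    case/orP: ij => /eqP ij.
      rewrite [tridiagB b j i]Bsym (Bup i j ij) mulrA -exprD mulrC.
      by congr (_ * 'X^_); lia.
    rewrite [tridiagB b i j]Bsym (Bup j i ij) mulrA -exprD mulrC.
    by congr (_ * 'X^_); lia.
  rewrite coefCM coefXn /= (_ : (_ == _) = ((i + j)%N == (x + y)%N)).
    by case: eqP; rewrite ?mulr1 ?mulr0.
  by move: ij xy; rewrite /adj; lia.
have axy : a y - a x != 0.
  by rewrite subr_eq0 inj_eq //; apply: contraNneq yI => ->.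
apply: contra_neq axy => /(congr1 (fun p : {poly K} => p`_(x + y).-1)).
rewrite coef0 coef_sum (bigD1 x) //= [X in _ + X]big1 => [|i /andP[iI ix]].
  rewrite coef_sum (bigD1 y) //= big1 => [|j jy]; rewrite coefB.
    by rewrite /adj xy eqxx /= !addr0 => /eqP; rewrite invr_eq0 => /eqP.
  rewrite eqn_add2l; case: eqP; rewrite ?andbF // => /val_inj jy'.
  by rewrite jy' eqxx in jy.
rewrite coef_sum big1 // => j _; rewrite coefB; case: ifP => // /andP[ij /eqP s].
case/eqP: ix; apply: val_inj => /=; have : i != y by apply: contraNneq yI => <-.
move: ij xy s; rewrite /adj -val_eqE /=; lia.
Qed.
End Crossing.

(** * Irreducibility *)

Section Irreducibility.
Variables (K : fieldType) (n : nat) (a : 'I_n -> K) (b : 'I_n.-1 -> K).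

Lemma tridiagB_diag i : tridiagB b i i = 0.
Proof. by rewrite tridiagB_far // neq_ltn ltnSn. Qed.

Lemma branch_root_chi i : injective a ->
  'X^3 %| (toPoly2 (chi a b)).[branch a (tridiagB b) i].
Proof.
move=> inja; set rho := branch _ _ i.
have -> : (toPoly2 (chi a b)).[rho] = \det (rho%:M + map_mx polyC (diagA a)
    + 'X *: map_mx polyC (tridiagB b)).
  rewrite toPoly2_chi -horner_evalE /char_poly -det_map_mx.
  congr (\det _); apply/matrixP => j k; rewrite !mxE.
  by rewrite /= /horner_eval hornerD hornerN hornerC hornerMn hornerX opprK addrA.
exact: branch_root i inja tridiagB_diag.
Qed.

Lemma irreducible_chi : (0 < n)%N -> injective a ->
    (forall I : {set 'I_n}, I != finset.set0 -> I != [set: 'I_n] ->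
       \sum_(i in I) drift a (tridiagB b) i != 0) ->
  irreducible_elt (chi a b).
Proof.
move=> n0 inja noncrit.
have mX : toPoly2 (chi a b) \is monic by rewrite toPoly2_chi char_poly_monic.
have sX : size (toPoly2 (chi a b)) = n.+1 by rewrite toPoly2_chi size_char_poly.
have nz0 : chi a b != 0.
  by apply: contra_eqN sX => /eqP ->; rewrite rmorph0 size_poly0.
split=> // [|q r qr].
  apply/negP => /unitrP[y [yX _]].
  have YX : toPoly2 y * toPoly2 (chi a b) = 1 by rewrite -rmorphM yX rmorph1.
  have Y0 : toPoly2 y != 0.
    by apply: contra_eq_neq YX => ->; rewrite mul0r eq_sym oner_neq0.
  have := size_Mmonic Y0 mX; rewrite YX sX size_poly1.
  by move: Y0; rewrite -size_poly_gt0; lia.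
have [q0 r0] : q != 0 /\ r != 0.
  by move: nz0; rewrite qr mulf_eq0 negb_or => /andP.
have QT : toPoly2 (chi a b) = toPoly2 q * toPoly2 r by rewrite qr rmorphM.
have [Q0 T0] : toPoly2 q != 0 /\ toPoly2 r != 0.
  by have := monic_neq0 mX; rewrite QT mulf_eq0 negb_or => /andP.
have msize_toPoly2 (p : {mpoly K[2]}) d : size (toPoly2 p) = d.+1 -> (d < msize p)%N.
  move=> sp; have := size_coef_toPoly2 p d; rewrite -subn_gt0.
  apply: leq_trans; rewrite size_poly_gt0.
  by have := lead_coef_eq0 (toPoly2 p); rewrite lead_coefE sp /= => ->;
    rewrite -size_poly_eq0 sp.
pose d := (size (toPoly2 q)).-1; pose e := (size (toPoly2 r)).-1.
have sQ : size (toPoly2 q) = d.+1 by rewrite prednK // size_poly_gt0.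
have sT : size (toPoly2 r) = e.+1 by rewrite prednK // size_poly_gt0.
have den : (d + e)%N = n.
  by have := sX; rewrite QT size_mul // sQ sT addnS /= addSn => -[].
(* Degrees in lambda and total degrees are both additive, and the former are at
   most the latter; for chi the total degree is at most the degree n in lambda,
   so that there is equality for q and r. *)
have [mq mr] : msize q = d.+1 /\ msize r = e.+1.
  have := msize_chi a b; rewrite qr msizeM //.
  move: (msize_toPoly2 q d sQ) (msize_toPoly2 r e sT).
  by move: (mmeasure _ q) (mmeasure _ r) => x y; lia.
have unit_of (p : {mpoly K[2]}) : p != 0 -> msize p = 1 -> p \is a GRing.unit.
  move=> p0 mp; have pC : p = (p@_0)%:MP by apply: msize1_polyC; rewrite mp.
  rewrite pC; apply: rmorph_unit; rewrite unitfE.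
  by apply: contraNneq p0 => p00; rewrite pC p00 mpolyC0.
have [d0|d0] := posnP d; first by left; apply: unit_of; rewrite // mq d0.
have [e0|e0] := posnP e; first by right; apply: unit_of; rewrite // mr e0.
have top (p : {mpoly K[2]}) k m :
    (msize p - k <= m)%N -> (size ((toPoly2 p)`_k)%R <= m)%N.
  exact: leq_trans (size_coef_toPoly2 p k).
have branch0 i : (branch a (tridiagB b) i).[0] = - a i.
  by rewrite !hornerE /= ?expr0n /= ?mulr0 ?addr0.
have [||||i|I cI sI] := @factor_root_sum K n (branch a (tridiagB b))
    (toPoly2 q) (toPoly2 r) d e _ sQ sT den d0.
- by move=> i j; rewrite !branch0 => /oppr_inj /inja.
- by apply: top; rewrite mq; lia.
- by apply: top; rewrite mr; lia.
- by apply: top; rewrite mq; lia.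
- by rewrite -QT; apply: branch_root_chi.
have /eqP[] : \sum_(i in I) drift a (tridiagB b) i != 0.
  apply: noncrit.
    by rewrite -cards_eq0 cI -lt0n.
  by apply: contra_eqN cI => /eqP ->; rewrite cardsT card_ord; lia.
rewrite -[RHS]sI coef_sum; apply: eq_bigr => i _.
by rewrite coefD coefC coefCM coefXn mulr1 add0r.
Qed.
End Irreducibility.

Theorem theorem2p2 (R : realType) (n : nat) (hn : (1 <= n)%N)
    (a : 'I_n -> R[i]) (ha : forall i j : 'I_n, i <> j -> a i <> a j) :
  exists Z : set ('I_n.-1 -> R[i]),
    [/\ zariski_closed Z,
        Z <> setT
      & forall b : 'I_n.-1 -> R[i], ~ Z b -> irreducible_elt (chi a b)].
Proof.
have inja : injective a.
  by move=> i j aij; have [//|/eqP/ha] := eqVneq i j.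
pose proper (I : {set 'I_n}) := (I != finset.set0) && (I != [set: 'I_n]).
pose obstruction : {mpoly R[i][n.-1]} :=
  \prod_(I | proper I) cross_sum a (@mpolyC _ R[i]) (fun k => 'X_k) I.
have obstructionE b : obstruction.@[b] =
    \prod_(I | proper I) \sum_(i in I) drift a (tridiagB b) i.
  rewrite rmorph_prod; apply: eq_bigr => I _ /=.
  rewrite cross_sum_morph => [|c]; last exact: mevalC.
  apply: eq_bigr => i _; congr (drift a (tridiagB _) i).
  by apply: boolp.funext => k /=; rewrite mevalXU.
exists [set b | obstruction.@[b] = 0]%classic; split.
- exists [set obstruction]%classic => b; split=> [b0 p ->|] //.
  by apply.
(* A point outside Z is sought on the curve b_k = t^k. *)
- pose g := \prod_(I | proper I) cross_sum a polyC (fun k : 'I_n.-1 => 'X^k) I.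
  have : g != 0.
    by apply/prodf_neq0 => I /andP[I0 IT]; apply: cross_sum_Xn_neq0.
  case/closed_nonrootP => t gt ZT.
  have : [set b | obstruction.@[b] = 0]%classic (fun k : 'I_n.-1 => t ^+ k).
    by rewrite ZT.
  move=> /= obt; case/negP: gt; rewrite rootE -obt obstructionE.
  rewrite -horner_evalE rmorph_prod; apply/eqP/eq_bigr => I _.
  rewrite cross_sum_morph => [|c]; last exact: hornerC.
  apply: eq_bigr => i _; congr (drift a (tridiagB _) i).
  by apply: boolp.funext => k /=; rewrite /horner_eval hornerXn.
- move=> b nZ; apply: irreducible_chi => // I I0 IT; apply/eqP => sum0.
  apply: nZ; rewrite /= obstructionE (bigD1 I) /=; last by apply/andP.
  by rewrite sum0 mul0r.
Qed.
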